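(* There exists a universal constant $c>0$ such that for every integer $d\ge 1$ and every nonzero linear subspace $C\subseteq\mathbb{F}_2^d$ (a linear code), $$c_1(\mathbb{F}_2^d/C^\perp)\ \ge\ c\cdot w(C)\cdot\frac{\dim(C)}{d+d\log\left(\frac{d}{\dim(C)}\right)}.$$
   Context: $\mathbb{F}_2^d=\{0,1\}^d$ is equipped with the Hamming metric $\rho(x,y)=|\{j:\ x_j\ne y_j\}|$. For a linear code $C$, $w(C)=\min_{x\in C\setminus\{0\}}\|x\|_1$ is the minimum Hamming weight of a nonzero codeword, and $C^\perp=\{x\in\mathbb{F}_2^d:\ \forall y\in C,\ \sum_{j=1}^d x_jy_j\equiv 0 \bmod 2\}$. $\mathbb{F}_2^d/C^\perp$ is the set of cosets $x+C^\perp$ with the quotient metric $\rho_{\mathbb{F}_2^d/C^\perp}(x+C^\perp,y+C^\perp)=\min\{\rho(u,v):\ u\in x+C^\perp,\ v\in y+C^\perp\}$ (this is a metric since $C^\perp$ acts on $\mathbb{F}_2^d$ by isometries via translation). Distortion: for metric spaces $(X,d_X),(Y,d_Y)$ and $f:X\to Y$, $\|f\|_{\mathrm{Lip}}=\sup_{x\ne y} d_Y(f(x),f(y))/d_X(x,y)$. If $f$ is one-to-one, $\mathrm{dist}(f)=\|f\|_{\mathrm{Lip}}\cdot\|f^{-1}\|_{\mathrm{Lip}}$ (with $f^{-1}$ defined on $f(X)$); otherwise $\mathrm{dist}(f)=\infty$. $c_Y(X)=\inf\{\mathrm{dist}(f): f:X\to Y\}$, and $c_1(X)=c_{L_1}(X)$,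 where $L_1=L_1([0,1])$. *)

(* Defs.v *)
From HB Require Import structures.
From mathcomp Require Import all_boot all_order all_algebra all_fingroup.
From mathcomp Require Import all_classical all_reals all_analysis measurable_realfun.

Set Implicit Arguments.
Unset Strict Implicit.
Unset Printing Implicit Defensive.

Import Order.TTheory GRing.Theory Num.Theory FinRing.Theory.
Import numFieldNormedType.Exports.

Local Open Scope classical_set_scope.
Local Open Scope ring_scope.

Section SubspaceMetric.
Context (R : realType) (X : metricType R) (A : set X).

Let sub_dist (x y : A) : R := mdist (set_val x) (set_val y).

Let sub_dist_ge0 x y : 0 <= sub_dist x y.
Proof. exact: mdist_ge0. Qed.

Let sub_dist_positivity x y : sub_dist x y = 0 -> x = y.
Proof. by move/mdist_positivity/val_inj. Qed.

Let sub_ballE (x : A) (e : R) : ball x e = [set y | sub_dist x y < e].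
Proof.
by apply/seteqP; split=> y /=; rewrite /ball /= /initial_ball /= ballEmdist.
Qed.

HB.instance Definition _ := PseudoMetric_isMetric.Build R A
  sub_dist_ge0 sub_dist_positivity sub_ballE.

End SubspaceMetric.

Section Distortion.
Context (R : realType).

(* The suprema are over subsets of [0, +oo], so the supremum of the empty set
   (when [X] has at most one point) is 0, not the -oo given by [ereal_sup]. *)
Definition Lip_norm (X Y : metricType R) (f : X -> Y) : \bar R :=
  maxe 0%E (ereal_sup
    [set (mdist (f p.1) (f p.2) / mdist p.1 p.2)%:E
      | p in [set p : X * X | p.1 != p.2]]).

(* A preimage, which is the inverse of [f] on [range f] when [f] is
   injective. *)
Definition range_inv (X Y : Type) (f : X -> Y) (y : range f) : X :=
  sval (cid2 (set_mem (valP y))).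

Definition distortion (X Y : metricType R) (f : X -> Y) : \bar R :=
  if `[< injective f >] then (Lip_norm f * Lip_norm (@range_inv X Y f))%E
  else +oo%E.

Definition Ydistortion (Y X : metricType R) : \bar R :=
  ereal_inf [set distortion f | f in [set: X -> Y]].

End Distortion.

Section LinearCode.
Context (d : nat).
Implicit Types (x y u v w : 'rV['F_2]_d) (C : {vspace 'rV['F_2]_d}).

Definition hamming x y : nat := #|[pred j : 'I_d | x 0 j != y 0 j]|.

Definition hweight x : nat := hamming x 0.

(* [d] is an upper bound of [hweight], hence neutral for the minimum, which is
   only meaningful when [C] has a nonzero vector. *)
Definition min_weight C : nat := \big[minn/d]_(x in C | x != 0) hweight x.

Definition dual_code C : {set 'rV['F_2]_d} :=
  [set x : 'rV['F_2]_d | [forall y in C, \sum_j x 0 j * y 0 j == 0]]%SET.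

Lemma dual_codeP C x :
  reflect (forall y, y \in C -> \sum_j x 0 j * y 0 j = 0) (x \in dual_code C).
Proof.
rewrite inE; apply: (iffP forall_inP) => h y yC; first exact/eqP/h.
by apply/eqP/h.
Qed.

Lemma dual_code_group_set C : group_set (dual_code C).
Proof.
apply/group_setP; split.
  apply/dual_codeP => y yC; rewrite big1// => j _.
  by rewrite [X in X * _]mxE mul0r.
move=> x x' /dual_codeP xD /dual_codeP x'D; apply/dual_codeP => y yC.
under eq_bigr do rewrite mxE mulrDl.
by rewrite big_split/= xD// x'D// addr0.
Qed.
Canonical dual_code_group C := Group (dual_code_group_set C).

End LinearCode.

(* The group law underlying [coset_of] is the addition of ['rV['F_2]_d].  It is
   commutative, so [coset_of (dual_code C)] consists of all the cosets
   x + C^perp (see [code_quotientP]).  The field [R] of the distances is a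
   phantom parameter of the type, so that it can carry a canonical metric. *)
Definition code_quotient (R : realType) (d : nat) (C : {vspace 'rV['F_2]_d}) :=
  coset_of (dual_code C).

Section CodeQuotient.
Context (R : realType) (d : nat) (C : {vspace 'rV['F_2]_d}).
Local Notation D := (dual_code C).
Local Notation Q := (code_quotient R C).
Implicit Types (x y u v w : 'rV['F_2]_d) (a b c : Q).

HB.instance Definition _ := Finite.on Q.

Lemma code_quotientP (A : {set 'rV['F_2]_d}) :
  (exists a, A = a) <-> exists x, A = [set x + z | z in D]%SET.
Proof.
have cosetE x : coset D x = [set x + z | z in D]%SET :> {set _}.
  have xN : x \in 'N(D)%g.
    rewrite inE; apply/fintype.subsetP => _ /imsetP[z zD ->].
    by rewrite conjgE (zmod_mulgC z x) mulKg.
  rewrite val_coset//.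
  apply/setP => y; rewrite mem_rcoset.
  apply/idP/imsetP => [yx|[z zD ->]].
    exists (y - x); first exact: yx.
    by rewrite addrC subrK.
  by rewrite zmodMgE zmodVgE addrAC subrr add0r.
split=> [[a ->]|[x ->]]; last by exists (coset D x); rewrite cosetE.
by exists (repr a); rewrite -cosetE coset_reprK.
Qed.

(* [d] is an upper bound of [hamming], hence neutral for the minimum over the
   nonempty set [a] x [b]. *)
Definition code_quotient_dist a b : nat :=
  \big[minn/d]_(p in finset.setX a b) hamming p.1 p.2.


Let distP a b : exists u v,
  [/\ u \in (a : {set _}), v \in (b : {set _}) &
      code_quotient_dist a b = hamming u v].
Proof.
have ha u v : (hamming u v <= d)%N.
  by rewrite /hamming (leq_trans (max_card _))// card_ord.
have rab : (repr a, repr b) \in finset.setX a b.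
  by rewrite inE /= !mem_repr_coset.
rewrite /code_quotient_dist -minEnat.
have [p pab ->] := @eq_bigmin _ _ _ d (repr a, repr b)
  (mem (finset.setX a b)) (fun p => hamming p.1 p.2) rab (fun _ _ => ha _ _).
by exists p.1, p.2; move: pab; rewrite !inE => /andP[].
Qed.

Let dist_le a b u v : u \in (a : {set _}) -> v \in (b : {set _}) ->
  (code_quotient_dist a b <= hamming u v)%N.
Proof.
move=> ua vb; rewrite /code_quotient_dist -minEnat.
have uv : (u, v) \in finset.setX a b by rewrite inE /= ua.
exact: (@bigmin_le_cond _ _ _ d (u, v) (mem (finset.setX a b))
  (fun p => hamming p.1 p.2) uv).
Qed.

Let mem_shift a b u v w : u \in (a : {set _}) -> v \in (a : {set _}) ->
  w \in (b : {set _}) -> (w + (u - v))%R \in (b : {set _}).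
Proof.
have [x aE] : exists x, a = [set x + z | z in D]%SET :> {set _}.
  by apply/code_quotientP; exists a.
have [y bE] : exists x, b = [set x + z | z in D]%SET :> {set _}.
  by apply/code_quotientP; exists b.
rewrite aE bE => /imsetP[z1 z1D ->] /imsetP[z2 z2D ->] /imsetP[z3 z3D ->].
apply/imsetP; exists (z3 + (z1 - z2)); last first.
  by rewrite opprD (addrACA x) subrr add0r -[in LHS]addrA.
exact: (groupM z3D (groupM z1D (groupVr z2D))).
Qed.

Let coset_eq a b u : u \in (a : {set _}) -> u \in (b : {set _}) -> a = b.
Proof. by move=> ua ub; rewrite -(coset_mem ua) -(coset_mem ub). Qed.

Let dist_sub a b c : (code_quotient_dist a c <=
  code_quotient_dist a b + code_quotient_dist b c)%N.
Proof.
have [u [v [ua vb ->]]] := distP a b.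
have [v' [w [v'b wc ->]]] := distP b c.
apply: (leq_trans (dist_le ua (mem_shift vb v'b wc))).
rewrite /hamming.
apply: (@leq_trans #|[predU [pred j | u 0 j != v 0 j]
                           & [pred j | v' 0 j != w 0 j]]|).
  apply/subset_leq_card/fintype.subsetP => j; rewrite !inE -negb_and.
  apply: contra => /andP[/eqP -> /eqP v'w].
  by rewrite !mxE v'w addrC subrK.
by rewrite -cardUI leq_addr.
Qed.

Let dist_sym a b : code_quotient_dist a b = code_quotient_dist b a.
Proof.
have hC u v : hamming u v = hamming v u.
  by apply: eq_card => j; rewrite !inE eq_sym.
have le a' b' : (code_quotient_dist a' b' <= code_quotient_dist b' a')%N.
  by have [u [v [ub va ->]]] := distP b' a'; rewrite hC; exact: dist_le.
by apply/eqP; rewrite eqn_leq !le.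
Qed.

Let dist0 a b : code_quotient_dist a b = 0%N -> a = b.
Proof.
have [u [v [ua vb ->]]] := distP a b => /card0_eq uv.
apply: (coset_eq ua); rewrite (_ : u = v)//.
by apply/rowP => j; have /negbFE/eqP := uv j.
Qed.

Let mdist_ a b : R := (code_quotient_dist a b)%:R.

Let mdist_xx a : mdist_ a a = 0.
Proof.
apply/eqP; rewrite pnatr_eq0 -leqn0.
have ra : repr a \in (a : {set _}) by exact: mem_repr_coset.
rewrite (leq_trans (dist_le ra ra))// leqn0.
by apply/eqP/eq_card0 => j; rewrite !inE eqxx.
Qed.

Let mdist_pos a b : mdist_ a b = 0 -> a = b.
Proof. by move/eqP; rewrite pnatr_eq0 => /eqP/dist0. Qed.

Let mdist_C a b : mdist_ a b = mdist_ b a.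
Proof. by rewrite /mdist_ dist_sym. Qed.

Let mdist_tri b a c : mdist_ a c <= mdist_ a b + mdist_ b c.
Proof. by rewrite -natrD ler_nat dist_sub. Qed.

HB.instance Definition _ := isMetric.Build R Q
  mdist_xx mdist_pos mdist_C mdist_tri.

End CodeQuotient.

Section L1.
Context (R : realType).

(* L_1([0, 1]) is taken as L_1 of the real line for Lebesgue measure restricted
   to [0, 1]; its elements are classes of functions equal almost everywhere,
   coerced to functions by choosing a representative. *)
Definition lebesgue01 : {measure set (measurableTypeR R) -> \bar R} :=
  mrestr lebesgue_measure (measurable_itv `[0 : R, 1 : R]).

Definition L1 : Type := LspaceType1 lebesgue01.

HB.instance Definition _ := gen_eqMixin L1.
HB.instance Definition _ := gen_choiceMixin L1.

Definition L1_dist (f g : L1) : R :=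
  fine 'N[lebesgue01]_1[EFin \o (fun t => f t - g t)%R]%E.

Let L1_Lfun (f : L1) : (f : R -> R) \in Lfun lebesgue01 1.
Proof.
apply/andP; split; rewrite inE/=.
  exact: measurable_funPT (generic_quotient.repr (LebesgueSpace.sort f)).
exact: Lebesgue_finite.
Qed.

Let L1_sub_Lfun (f g : L1) : (fun t => f t - g t) \in Lfun lebesgue01 1.
Proof.
have [_ addL] := Lfun_addr_closed lebesgue01 (lexx 1%E).
exact: (addL _ _ (L1_Lfun f) (Lfun_oppr_closed (L1_Lfun g))).
Qed.

Let L1_sub_mfun (f g : L1) : measurable_fun setT (fun t : R => f t - g t).
Proof. by have /andP[+ _] := L1_sub_Lfun f g; rewrite inE. Qed.

Let L1_dist_fin (f g : L1) :
  (L1_dist f g)%:E = 'N[lebesgue01]_1[EFin \o (fun t => f t - g t)%R]%E.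
Proof.
rewrite fineK// fin_numElt (lt_le_trans _ (Lnorm_ge0 _ _ _))//=.
by have /andP[_] := L1_sub_Lfun f g; rewrite inE.
Qed.

Let L1_dist_xx (f : L1) : L1_dist f f = 0.
Proof.
apply: EFin_inj; rewrite L1_dist_fin Lnorm1.
by under eq_integral do rewrite /= subrr normr0; rewrite integral0.
Qed.

Let L1_dist_sym (f g : L1) : L1_dist f g = L1_dist g f.
Proof.
rewrite /L1_dist -oppe_Lnorm; congr (fine (Lnorm _ _ _)).
by apply/funext => t /=; congr EFin; rewrite opprB.
Qed.

Let L1_dist_triangle (g f h : L1) : L1_dist f h <= L1_dist f g + L1_dist g h.
Proof.
rewrite -lee_fin EFinD !L1_dist_fin.
rewrite (_ : (fun t => f t - h t) =
  (fun t => f t - g t) \+ (fun t => g t - h t)).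
  by apply: eminkowski => //; exact: L1_sub_mfun.
by apply/funext => t /=; rewrite addrA subrK.
Qed.

Let L1_dist_pos (f g : L1) : L1_dist f g = 0 -> f = g.
Proof.
move=> /(congr1 (@EFin R)); rewrite L1_dist_fin => fg0.
have fg : f = g %[ae lebesgue01].
  have ae0 mfg := Lnorm_eq0_eq0 mfg lte01 fg0.
  apply: filterS (ae0 _); last first.
    by apply/measurable_EFinP; exact: L1_sub_mfun.
  by move=> t /(_ I)/= [/subr0_eq].
have : LebesgueSpace.sort f = LebesgueSpace.sort g.
  rewrite -[LHS]generic_quotient.reprK -[RHS]generic_quotient.reprK.
  by apply/generic_quotient.eqmodP/asboolP.
case: f g {fg fg0} => [f [[Pf]]] [g [[Pg]]] /= fg.
by case: _ / fg Pg => Pg; rewrite (Prop_irrelevance Pf Pg).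
Qed.

HB.instance Definition _ :=
  isMetric.Build R L1 L1_dist_xx L1_dist_pos L1_dist_sym L1_dist_triangle.

End L1.

Definition c1 (R : realType) (X : metricType R) : \bar R :=
  Ydistortion (L1 R) X.

(* Main.v *)
Require Import Defs.
From HB Require Import structures.
From mathcomp Require Import all_boot all_order all_algebra all_fingroup.
From mathcomp Require Import finfield ring lra.
From mathcomp Require Import all_classical all_reals all_analysis measurable_realfun.

Set Implicit Arguments.
Unset Strict Implicit.
Unset Printing Implicit Defensive.

Import Order.TTheory GRing.Theory Num.Theory.
Import numFieldNormedType.Exports.

Local Open Scope ring_scope.

(** A [C^perp]-invariant function on F_2^d has its Fourier coefficients supported
    on [C], and a nonzero [c] in [C] has weight at least [w(C)]; Parseval turns
    this into a Poincare inequality with constant proportional to [w(C)].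
    Decomposing into level sets and integrating carries it over to maps into
    L_1, so that an embedding of F_2^d / C^perp has distortion at least
    [2 w(C) m / d], [m] being the mean distance in the quotient.  Finally
    [m >= dim C / (12 (1 + ln (d / dim C)))]: by Jensen, [exp (- s m)] is at most
    the mean of [exp (- s rho)], hence at most the sum of [exp (- s |x + z|)]
    over [z] in [C^perp], averaged over [x], which is
    [(1 + exp (- s)) ^ d / 2 ^ (dim C)]; take [exp (- s) = dim C / (4 d)]. *)

(** * Arithmetic in characteristic 2 and sums of squared differences *)

Lemma F2_cases (a : 'F_2) : a = 0 \/ a = 1.
Proof.
by case: a => [[|[|//]] p]; [left|right]; apply/val_inj.
Qed.

(** Translation by [x] is its own inverse; this is what lets [reindex_onto] use the same map in both
    directions below. *)
Lemma rVF2_addK d (x y : 'rV['F_2]_d) : x + (x + y) = y.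
Proof.
rewrite addrA; apply/rowP => j; rewrite !mxE.
by case: (F2_cases (x 0 j)) => ->; rewrite (_ : _ + _ + y 0 j = (1 + 1) + y 0 j
  :> 'F_2) // (_ : 1 + 1 = 0 :> 'F_2) ?add0r//; apply/val_inj.
Qed.

Lemma rVF2_addxx d (x : 'rV['F_2]_d) : x + x = 0.
Proof. by rewrite -[RHS](rVF2_addK x) addr0. Qed.

Lemma sumr_sqr2 (R : comPzRingType) (I : finType) (P : pred I) (f : I -> R) :
  (\sum_(i | P i) f i) ^+ 2 = \sum_(i | P i) \sum_(j | P j) f i * f j.
Proof.
by rewrite expr2 mulr_suml; apply: eq_bigr => i _; rewrite mulr_sumr.
Qed.

(** In Fourier terms the right-hand side is the total energy minus that of the zero frequency, which
    is how [poincare2] reads it. *)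
Lemma sum_sqr_diff (R : comPzRingType) (T : finType) (f : T -> R) :
  \sum_x \sum_y (f x - f y) ^+ 2
    = 2 * (#|T|%:R * (\sum_x f x ^+ 2) - (\sum_x f x) ^+ 2).
Proof.
rewrite (eq_bigr (fun x => #|T|%:R * f x ^+ 2 + \sum_y f y ^+ 2
    - 2 * (f x * \sum_y f y))); last first.
  move=> x _; rewrite (eq_bigr (fun y => f x ^+ 2 + f y ^+ 2 - 2 * (f x * f y))).
    by rewrite sumrB big_split/= sumr_const mulr_natl -!mulr_sumr.
  by move=> y _; ring.
rewrite sumrB big_split/= sumr_const -!mulr_sumr -mulr_suml.
by rewrite -[_ *+ _]mulr_natl; ring.
Qed.

(** * Fourier analysis on F_2^d and the Poincare inequality for squares *)

Section Fourier.
Context (R : realType) (d : nat).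
Local Notation V := 'rV['F_2]_d.
Implicit Types (x y z c : V) (C : {vspace V}) (F : V -> R).

(** The Walsh character: the exponent is summed in ['F_2], then read as 0 or 1 through the coercion
    to [nat]. *)
Definition char c x : R := (-1) ^+ (\sum_j c 0 j * x 0 j)%R.

Lemma signF2D (a b : 'F_2) : (-1) ^+ (a + b)%R = (-1) ^+ a * (-1) ^+ b :> R.
Proof.
by case: (F2_cases a) => ->; case: (F2_cases b) => ->;
  rewrite /= ?expr0 ?expr1 ?mulrNN ?mul1r ?mulr1.
Qed.

Lemma charC c x : char c x = char x c.
Proof. by rewrite /char; under eq_bigr do rewrite mulrC. Qed.

Lemma charD c x y : char c (x + y) = char c x * char c y.
Proof.
rewrite /char -signF2D; congr (_ ^+ nat_of_ord _).
by rewrite -big_split/=; apply: eq_bigr => j _; rewrite mxE mulrDr.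
Qed.

Lemma char_delta c (j : 'I_d) : char c (delta_mx 0 j) = if c 0 j == 0 then 1 else -1.
Proof.
have cj : \sum_i c 0 i * (delta_mx 0 j : V) 0 i = c 0 j.
  rewrite (bigD1 j)//= mxE !eqxx mulr1 big1 ?addr0// => i ij.
  by rewrite mxE (negPf ij) andbF mulr0.
rewrite /char cj.
by case: (F2_cases (c 0 j)) => ->.
Qed.

Lemma hweight_sum x : hweight x = (\sum_j (x 0 j != 0)%R)%N.
Proof.
rewrite /hweight /hamming -sum1_card big_mkcond/=; apply: eq_bigr => j _.
by rewrite !inE mxE; case: ifP.
Qed.

Lemma hamming_hweight x y : hamming x y = hweight (x + y).
Proof.
apply: eq_card => j; rewrite !inE !mxE.
by case: (F2_cases (x 0 j)) => ->; case: (F2_cases (y 0 j)) => ->.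
Qed.

Lemma min_weight_le C c : c \in C -> c != 0 -> (min_weight C <= hweight c)%N.
Proof.
move=> cC c0; rewrite /min_weight -minEnat.
exact: (@bigmin_le_cond _ _ _ d c (fun x => (x \in C) && (x != 0)) _
  (introT andP (conj cC c0))).
Qed.

(** If [x] is outside the dual code, some [y] in [C] has [char y x = -1]; translating [C] by [y]
    permutes it and negates the sum. *)
Lemma sum_char_code C x :
  \sum_(c in C) char c x = if x \in dual_code C then #|C|%:R else 0.
Proof.
case: ifPn => [/dual_codeP xD|].
  rewrite (eq_bigr (fun=> 1)) ?sumr_const// => c cC.
  by rewrite charC /char xD.
rewrite inE => /forall_inPn[y yC xy].
have cy : char y x = -1.
  rewrite charC /char; move: xy.
  by case: (F2_cases (\sum_j x 0 j * y 0 j)) => ->.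
set S := LHS; have : S = - S.
  rewrite {1}/S (reindex_onto (+%R y) (+%R y)) => [/=|c _]; last first.
    exact: rVF2_addK.
  rewrite -sumrN; apply: eq_big => [c|c _].
    by rewrite rVF2_addK eqxx andbT rpredDl.
  by rewrite charC charD charC cy mulN1r charC.
by move=> /eqP; rewrite -addr_eq0 -mulr2n mulrn_eq0 => /eqP.
Qed.

(** Translation by a basis vector in the support of [c] negates the sum. *)
Lemma sum_char_eq0 c : c != 0 -> \sum_x char c x = 0.
Proof.
move=> c0; have [j cj] : exists j, c 0 j != 0.
  apply/existsP; apply: contraNT c0 => /existsPn c0.
  by apply/eqP/rowP => j; rewrite mxE; apply/eqP/negPn/c0.
set S := LHS; have : S = - S.
  rewrite {1}/S (reindex_onto (+%R (delta_mx 0 j)) (+%R (delta_mx 0 j)))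
    => [/=|x _]; last exact: rVF2_addK.
  rewrite -sumrN; apply: eq_big => [x|x _].
    by rewrite rVF2_addK eqxx.
  by rewrite charD char_delta (negPf cj) mulN1r.
by move=> /eqP; rewrite -addr_eq0 -mulr2n mulrn_eq0 => /eqP.
Qed.

Lemma char0 x : char 0 x = 1.
Proof. by rewrite /char big1// => j _; rewrite mxE mul0r. Qed.

Definition fourier F c : R := \sum_x F x * char c x.

Lemma fourier0 F : fourier F 0 = \sum_x F x.
Proof. by apply: eq_bigr => x _; rewrite char0 mulr1. Qed.

Definition dual_invariant C F := forall x z, z \in dual_code C -> F (x + z) = F x.

(** Expand the squares and sum over [c] first: by [sum_char_code] only the pairs [x], [x + z] with
    [z] in the dual survive, and [F] agrees on them. *)
Lemma parseval_code C F : dual_invariant C F ->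
  \sum_(c in C) fourier F c ^+ 2
    = (#|C| * #|dual_code C|)%:R * \sum_x F x ^+ 2.
Proof.
move=> Finv; under eq_bigr do rewrite sumr_sqr2.
rewrite exchange_big mulr_sumr; apply: eq_bigr => x _ /=.
(* Substitute [y = x + z]: the two characters then multiply to [char c z]. *)
rewrite exchange_big/= (reindex_onto (+%R x) (+%R x))/=; last first.
  by move=> y _; exact: rVF2_addK.
under eq_bigl do rewrite rVF2_addK eqxx.
rewrite (eq_bigr (fun z =>
    if z \in dual_code C then #|C|%:R * F x ^+ 2 else 0)); last first.
  move=> z _; rewrite (eq_bigr (fun c => F x * F (x + z) * char c z)).
    rewrite -mulr_sumr sum_char_code; case: ifP => zD; last by rewrite mulr0.
    by rewrite Finv// mulrC expr2.
  by move=> c _; rewrite mulrACA -charD rVF2_addK.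
by rewrite -big_mkcond sumr_const natrM mulrAC -[LHS]mulr_natr.
Qed.

(** Parseval for the constant function 1, whose only nonzero coefficient is at 0. *)
Lemma card_code_dual C : (#|C| * #|dual_code C| = #|{: V}|)%N.
Proof.
have /parseval_code : dual_invariant C (fun=> 1) by [].
rewrite (bigD1 0) ?mem0v//= big1; last first.
  move=> c /andP[_ c0]; rewrite /fourier.
  by under eq_bigr do rewrite mul1r; rewrite sum_char_eq0// expr0n.
rewrite fourier0.
under [X in _ = _ * X]eq_bigr do rewrite expr1n.
have -> : \sum_(x : V) 1 = #|{: V}|%:R :> R by rewrite sumr_const.
have N0 : #|{: V}|%:R != 0 :> R.
  by rewrite pnatr_eq0 -lt0n; apply/card_gt0P; exists 0.
by rewrite addr0 expr2 => /(mulIf N0)/eqP; rewrite eqr_nat => /eqP.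
Qed.

(** A shift by [delta_mx 0 j] multiplies the coefficient at [c] by the sign
    [char c (delta_mx 0 j)]. *)
Lemma fourier_diff F (j : 'I_d) c : fourier (fun x => F (x + delta_mx 0 j) - F x) c
  = (if c 0 j == 0 then 0 else -2) * fourier F c.
Proof.
rewrite /fourier; under eq_bigr do rewrite mulrBl.
rewrite sumrB (_ : \sum_x F (x + delta_mx 0 j) * char c x =
    char c (delta_mx 0 j) * \sum_x F x * char c x); last first.
  rewrite mulr_sumr [RHS](reindex_onto (+%R (delta_mx 0 j)) (+%R (delta_mx 0 j)))
    => [/=|x _]; last exact: rVF2_addK.
  apply: eq_big => [x|x _]; first by rewrite rVF2_addK eqxx.
  rewrite (addrC _ x) charD char_delta.
  by case: ifP => _; ring.
by rewrite char_delta; case: ifP => _; ring.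
Qed.

(** After Parseval, [c] contributes [4 * min_weight C] times its squared coefficient on the left and
    [4 * hweight c] times it on the right; compare term by term for [c != 0]. *)
Lemma poincare2 C F : dual_invariant C F ->
  2 * (min_weight C)%:R * \sum_x \sum_y (F x - F y) ^+ 2
   <= #|{: V}|%:R * \sum_j \sum_x (F (x + delta_mx 0 j) - F x) ^+ 2.
Proof.
move=> Finv; rewrite sum_sqr_diff -(card_code_dual C).
rewrite [leRHS]mulr_sumr (eq_bigr (fun j => \sum_(c in C)
    (if c 0 j == 0 then 0 else 4) * fourier F c ^+ 2)); last first.
  move=> j _; rewrite -(@parseval_code C (fun x => F (x + delta_mx 0 j) - F x)); last first.
    by move=> x z zD; rewrite (addrAC x) (Finv (x + delta_mx 0 j) z zD) (Finv x z zD).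
  apply: eq_bigr => c _; rewrite fourier_diff exprMn.
  by case: ifP => _; rewrite ?expr0n// sqrrN -natrX.
(* The [c = 0] term of Parseval is the square of the sum of [F], which cancels the subtracted
   square. *)
rewrite exchange_big/= -parseval_code// [X in X - _](bigD1 0) ?mem0v//=.
rewrite fourier0 addrAC subrr add0r !mulr_sumr [leRHS](bigD1 0) ?mem0v//=.
rewrite [X in _ <= X + _]big1 ?add0r => [|j _]; last by rewrite mxE eqxx mul0r.
apply: ler_sum => c /andP[cC c0].
rewrite -mulr_suml [leLHS]mulrA; apply: ler_wpM2r; first exact: sqr_ge0.
rewrite (eq_bigr (fun j => 4 * (c 0 j != 0)%:R)); last first.
  by move=> j _; case: eqP; rewrite ?mulr0 ?mulr1.
rewrite -mulr_sumr -natr_sum -hweight_sum mulrAC -!natrM ler_nat.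
exact: leq_mul (min_weight_le cC c0).
Qed.

End Fourier.

(** * From squares to absolute values by level sets *)

(** The gap above [s_k] lies between [a] and [b] exactly when one of them exceeds [s_k] and the
    other does not. The square changes nothing on differences of indicators, but gives the form
    required by [poincare2]. *)
Lemma layer_cake (R : realType) (s : seq R) : sorted <%R s ->
  {in s &, forall a b, `|a - b| = \sum_(0 <= i < (size s).-1)
     (s`_i.+1 - s`_i) * ((s`_i < a)%R%:R - (s`_i < b)%R%:R) ^+ 2}.
Proof.
move=> ss.
have mon i j : (i < size s)%N -> (j < size s)%N -> (s`_i < s`_j) = (i < j)%N.
  move=> ?? ; exact: (lt_sorted_ltn_nth 0 ss).
suff main i j : (i <= j)%N -> (j < size s)%N ->
    s`_j - s`_i = \sum_(0 <= k < (size s).-1)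
     (s`_k.+1 - s`_k) * ((s`_k < s`_j)%R%:R - (s`_k < s`_i)%R%:R) ^+ 2.
  have le i j : (i <= j)%N -> (j < size s)%N -> s`_i <= s`_j.
    move=> ij js; rewrite leNgt mon ?(leq_ltn_trans ij)//.
    by rewrite -leqNgt.
  move=> _ _ /(nthP 0)[i si <-] /(nthP 0)[j sj <-].
  case: (leqP i j) => [ij|/ltnW ij].
    rewrite distrC ger0_norm ?subr_ge0 ?le// main//.
    by apply: eq_bigr => k _; rewrite -sqrrN opprB.
  by rewrite ger0_norm ?subr_ge0 ?le// main.
move=> ij js.
have js' : (j <= (size s).-1)%N by rewrite -ltnS prednK//; case: size js.
rewrite -(telescope_sumr _ ij).
(* Below [i] both indicators are 1 and from [j] on both are 0; only the range from [i] to [j]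
   survives, where the gaps telescope. *)
rewrite [RHS](big_cat_nat (leq0n i) (leq_trans ij js'))/=.
rewrite [X in _ = _ + X](big_cat_nat ij js')/=.
rewrite [X in _ = X + _]big_nat_cond [X in _ = X + _]big1 ?add0r => [|k /andP[/andP[_ ki] _]]; last first.
  have kj : (k < j)%N by exact: leq_trans ki ij.
  have ks : (k < size s)%N by exact: ltn_trans kj js.
  have is' : (i < size s)%N by exact: leq_ltn_trans ij js.
  by rewrite !mon// ki kj subrr expr0n mulr0.
rewrite [X in _ = _ + X]big_nat_cond [X in _ = _ + X]big1 ?addr0; last first.
  move=> k /andP[/andP[jk ks] _].
  have ks' : (k < size s)%N by rewrite (leq_trans ks) ?leq_pred.
  rewrite (mon k j ks' js) (mon k i ks' (leq_ltn_trans ij js)).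
  rewrite !ltnNge jk (leq_trans ij jk).
  by rewrite subrr expr0n mulr0.
apply: eq_big_nat => k /andP[ik kj].
rewrite (mon k j (ltn_trans kj js) js) kj.
rewrite (mon k i (ltn_trans kj js) (leq_ltn_trans ij js)) ltnNge ik.
by rewrite subr0 expr1n mulr1.
Qed.

Section L1Poincare.
Context (R : realType) (d : nat).
Local Notation V := 'rV['F_2]_d.
Implicit Types (x y z c : V) (C : {vspace V}) (F : V -> R).

(* Each superlevel set of [F] is again [C^perp]-invariant, and for indicators
   the absolute difference is its own square. *)
Lemma poincare1 C F : dual_invariant C F ->
  2 * (min_weight C)%:R * \sum_x \sum_y `|F x - F y|
   <= #|{: V}|%:R * \sum_j \sum_x `|F (x + delta_mx 0 j) - F x|.
Proof.
move=> Finv.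
pose s := sort <=%R (undup [seq F x | x : V]).
have ss : sorted <%R s by rewrite sort_lt_sorted undup_uniq.
have Fs x : F x \in s by rewrite mem_sort mem_undup map_f// mem_enum.
pose w i := s`_i.+1 - s`_i.
pose g i x : R := (s`_i < F x)%R%:R.
have E x y : `|F x - F y| = \sum_(0 <= i < (size s).-1) w i * (g i x - g i y) ^+ 2.
  exact: layer_cake.
rewrite (eq_bigr (fun x => \sum_(0 <= i < (size s).-1)
   w i * \sum_y (g i x - g i y) ^+ 2)); last first.
  move=> x _; under eq_bigr do rewrite E.
  by rewrite exchange_big/=; apply: eq_bigr => i _; rewrite mulr_sumr.
rewrite [X in _ <= _ * X](eq_bigr (fun j => \sum_(0 <= i < (size s).-1)
   w i * \sum_x (g i (x + delta_mx 0 j) - g i x) ^+ 2)); last first.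
  move=> j _; under eq_bigr do rewrite E.
  by rewrite exchange_big/=; apply: eq_bigr => i _; rewrite mulr_sumr.
rewrite exchange_big/= [X in _ <= _ * X]exchange_big/= !mulr_sumr.
rewrite !big_nat; apply: ler_sum => i /andP[_ il].
(* The weights are gaps of an increasing list, hence nonnegative: a single threshold is enough. *)
rewrite -!mulr_sumr mulrCA [leRHS]mulrCA ler_wpM2l//.
  rewrite subr_ge0; apply: ltW; rewrite (lt_sorted_ltn_nth 0 ss) ?inE//.
    by apply: leq_trans il _; exact: leq_pred.
  by move: il; case: size.
by apply: poincare2 => x z zD; rewrite /g Finv.
Qed.

End L1Poincare.

(** * Integration of pointwise inequalities to L_1 *)

Section L1Sums.
Context (R : realType).
Local Notation mu := (@lebesgue01 R).

Lemma measurable_L1 (f : L1 R) : measurable_fun [set: measurableTypeR R] (f : R -> R).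
Proof. exact: measurable_funPT (generic_quotient.repr (LebesgueSpace.sort f)). Qed.

(** The distance is a [fine], so the norm must first be shown finite; this comes from the stability
    of [Lfun] under differences. *)
Lemma L1_mdistE (f g : L1 R) :
  (mdist f g)%:E = (\int[mu]_t `|f t - g t|%:E)%E.
Proof.
have [_ addL] := Lfun_addr_closed mu (lexx 1%E).
have L1_Lfun (h : L1 R) : (h : R -> R) \in Lfun mu 1.
  apply/andP; split; rewrite inE/=; first exact: measurable_L1.
  exact: Lebesgue_finite.
have /andP[_] : (fun t => f t - g t) \in Lfun mu 1.
  exact: (addL _ _ (L1_Lfun f) (Lfun_oppr_closed (L1_Lfun g))).
rewrite inE/= /finite_norm => fin.
rewrite /mdist/= /L1_dist fineK; last first.
  by rewrite fin_numElt fin (lt_le_trans _ (Lnorm_ge0 _ _ _)).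
by rewrite Lnorm1.
Qed.

Lemma measurable_L1_dist (f g : L1 R) :
  measurable_fun [set: measurableTypeR R] (fun t => `|f t - g t|).
Proof.
apply: measurableT_comp => //.
by apply: measurable_funB; exact: measurable_L1.
Qed.

Lemma L1_sum_mdist (c : R) (I : finType) (p q : I -> L1 R) : 0 <= c ->
  (c * \sum_i mdist (p i) (q i))%:E
  = (\int[mu]_t (c * \sum_i `|p i t - q i t|)%:E)%E.
Proof.
move=> c0; rewrite EFinM -sumEFin; under eq_bigr do rewrite L1_mdistE.
rewrite -ge0_integral_sum//; last first.
  by move=> i; apply/measurable_EFinP; exact: measurable_L1_dist.
rewrite -ge0_integralZl//; last 2 first.
- apply: emeasurable_sum => i.
  by apply/measurable_EFinP; exact: measurable_L1_dist.
- by move=> t _; apply: sume_ge0 => i _; rewrite lee_fin.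
by apply: eq_integral => t _; rewrite EFinM sumEFin.
Qed.

(** Integrating over [t] carries linear inequalities between distances from the real line to L_1. *)
Lemma ler_L1_sum_mdist (a b : R) (I J : finType) (p q : I -> L1 R)
    (p' q' : J -> L1 R) : 0 <= a -> 0 <= b ->
  (forall t, a * \sum_i `|p i t - q i t| <= b * \sum_j `|p' j t - q' j t|) ->
  a * \sum_i mdist (p i) (q i) <= b * \sum_j mdist (p' j) (q' j).
Proof.
move=> a0 b0 le; rewrite -lee_fin !L1_sum_mdist//; apply: ge0_le_integral => //.
- by move=> t _; rewrite lee_fin mulr_ge0// sumr_ge0.
- apply/measurable_EFinP; apply: measurable_funM => //.
  by apply: measurable_sum => i; exact: measurable_L1_dist.
- apply/measurable_EFinP; apply: measurable_funM => //.
  by apply: measurable_sum => i; exact: measurable_L1_dist.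
- by move=> t _; rewrite lee_fin.
Qed.

(** Equal elements of [L1] have the same chosen representative, so [f] is invariant at every [t],
    and [poincare1] applies pointwise. *)
Lemma poincare_L1 (d : nat) (C : {vspace 'rV['F_2]_d}) (f : 'rV['F_2]_d -> L1 R) :
  (forall x z, z \in dual_code C -> f (x + z) = f x) ->
  2 * (min_weight C)%:R * \sum_x \sum_y mdist (f x) (f y)
   <= #|{: 'rV['F_2]_d}|%:R * \sum_j \sum_x mdist (f (x + delta_mx 0 j)) (f x).
Proof.
move=> finv; rewrite !pair_bigA/=; apply: ler_L1_sum_mdist => // t.
have /poincare1 : dual_invariant C (fun x => f x t).
  by move=> x z zD; rewrite finv.
by rewrite !pair_bigA.
Qed.

End L1Sums.

(** * Elementary estimates on exp and ln *)

(* Jensen's inequality for [exp], through its tangent line at the mean. *)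
Lemma jensen_expR (R : realType) (T : finType) (X : T -> R) (m : R) :
  \sum_i X i = #|T|%:R * m -> #|T|%:R * expR m <= \sum_i expR (X i).
Proof.
move=> Xm.
have -> : #|T|%:R * expR m = \sum_i expR m * (1 + (X i - m)).
  rewrite -mulr_sumr big_split/= sumrB Xm !sumr_const -(mulr_natl m).
  by rewrite subrr addr0 mulrC.
apply: ler_sum => i _.
rewrite -[X in _ <= expR X](subrKC m) expRD ler_wpM2l ?expR_ge0//.
exact: expR_ge1Dx.
Qed.

(** The logarithm is [ln 4 + ln (n / k)], at most [3 * (1 + ln (n / k))] since [ln 4 <= 3]; the
    constant 12 is 4 times this 3. *)
Lemma mean_le_of_ln (R : realType) (k n m : R) : 0 < k -> k <= n -> 0 <= m ->
  k / 4 <= - ln (k / (4 * n)) * m -> k / (12 * (1 + ln (n / k))) <= m.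
Proof.
move=> k0 kn m0.
have n0 : 0 < n by exact: lt_le_trans kn.
have L0 : 0 <= ln (n / k) by rewrite ln_ge0// ler_pdivlMr// mul1r.
have -> : - ln (k / (4 * n)) = ln 4 + ln (n / k).
  rewrite -lnV ?posrE ?divr_gt0 ?mulr_gt0// invf_div -mulrA.
  by rewrite (@lnM _ 4 (n / k)) ?posrE ?divr_gt0.
have l4 : ln 4 <= 3 :> R.
  by have := @le_ln1Dx R 3; rewrite (_ : 1 + 3 = 4); [apply; lra|lra].
move=> h; rewrite ler_pdivrMr; last by lra.
suff : (ln 4 + ln (n / k)) * m <= 3 * (1 + ln (n / k)) * m by lra.
by rewrite ler_wpM2r//; lra.
Qed.

(** Invert [1 - 1/2 <= exp (- 1/2)]. It serves to compare [2 ^+ k] with [exp (k / 2)]. *)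
Lemma expR_half_le2 (R : realType) : expR 2^-1 <= 2 :> R.
Proof.
have := @expR_ge1Dx R (- 2^-1); rewrite expRN => h.
rewrite -[leRHS]invrK -lef_pV2 ?posrE ?invr_gt0 ?expR_gt0 ?invr_gt0//.
by rewrite invrK; lra.
Qed.

Lemma dim_code_le (d : nat) (C : {vspace 'rV['F_2]_d}) : (\dim C <= d)%N.
Proof. by rewrite (leq_trans (dimvS (subvf C)))// dimvf /dim/= mul1n. Qed.

(** * Lower bound on the mean distance in the quotient *)

Section QuotientDistance.
Context (R : realType) (d : nat) (C : {vspace 'rV['F_2]_d}).
Local Notation V := 'rV['F_2]_d.
Local Notation D := (dual_code C).
Local Notation Q := (code_quotient R C).
Implicit Types (x y z : V) (a b : Q).

Definition code_coset x : Q := coset D x.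

Lemma mem_code_coset x y : (y \in (code_coset x : {set V})) = (x + y \in D).
Proof.
have xN : x \in 'N(D)%g.
  rewrite inE; apply/fintype.subsetP => _ /imsetP[z zD ->].
  by rewrite conjgE (FinRing.zmod_mulgC z x) mulKg.
have Nx : x + y = y - x.
  by rewrite addrC; congr (_ + _); apply: (addrI x); rewrite subrr rVF2_addxx.
by rewrite val_coset// mem_rcoset FinRing.zmodMgE FinRing.zmodVgE Nx.
Qed.

Lemma dual_code0 : 0 \in D.
Proof. exact: (group1 (dual_code_group C)). Qed.

Lemma code_coset_refl x : x \in (code_coset x : {set V}).
Proof. by rewrite mem_code_coset rVF2_addxx dual_code0. Qed.

Lemma code_cosetK x z : z \in D -> code_coset (x + z) = code_coset x.
Proof.
by move=> zD; apply: coset_mem; rewrite mem_code_coset rVF2_addK.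
Qed.

Lemma hamming_le x y : (hamming x y <= d)%N.
Proof. by rewrite /hamming (leq_trans (max_card _))// card_ord. Qed.

Lemma code_quotient_dist_le x y :
  (code_quotient_dist (code_coset x) (code_coset y) <= hweight (x + y))%N.
Proof.
rewrite -hamming_hweight /code_quotient_dist -minEnat.
apply: (@bigmin_le_cond _ _ _ d (x, y)
  (mem (finset.setX (code_coset x) (code_coset y)))
  (fun p => hamming p.1 p.2)).
by apply/finset.setXP; split; exact: code_coset_refl.
Qed.

(** Moving both representatives by dual codewords changes [x + y] by a single dual codeword, so one
    [z] replaces the pair. *)
Lemma code_quotient_dist_attained x y : exists2 z, z \in D &
  code_quotient_dist (code_coset x) (code_coset y) = hweight (x + y + z).
Proof.
have xy : (x, y) \in finset.setX (code_coset x) (code_coset y).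
  by apply/finset.setXP; split; exact: code_coset_refl.
rewrite /code_quotient_dist -minEnat.
have [[u v] uv ->] := @eq_bigmin _ _ _ d (x, y)
  (mem (finset.setX (code_coset x) (code_coset y)))
  (fun p => hamming p.1 p.2) xy (fun _ _ => hamming_le _ _).
move: uv => /finset.setXP[]/=; rewrite !mem_code_coset => xu yv; exists (x + u + (y + v)).
  exact: (groupM (G := dual_code_group C) xu yv).
by rewrite hamming_hweight (addrACA x u) rVF2_addK.
Qed.

Lemma exp_hweight (t : R) x :
  t ^+ hweight x = \prod_j (if x 0 j == 0 then 1 else t).
Proof.
rewrite hweight_sum -prodrXr; apply: eq_bigr => j _.
by case: eqP.
Qed.

(** The weight enumerator of the whole space factors over coordinates, each contributing [1 + t]. *)
Lemma sum_exp_hweight (t : R) : \sum_(x : V) t ^+ hweight x = (1 + t) ^+ d.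
Proof.
under eq_bigr do rewrite exp_hweight.
have -> : (1 + t) ^+ d = \prod_(j < d) \sum_(a : 'F_2) (if a == 0 then 1 else t).
  have -> : \sum_(a : 'F_2) (if a == 0 then 1 else t) = 1 + t.
    by rewrite !big_ord_recl big_ord0 addr0.
  by rewrite prodr_const card_ord.
rewrite bigA_distr_bigA/= (reindex (fun f : {ffun 'I_d -> 'F_2} => \row_j f j))/=.
  by apply: eq_bigr => f _; apply: eq_bigr => j _; rewrite mxE.
exists (fun x : V => [ffun j => x 0 j]) => [f _|x _].
  by apply/ffunP => j; rewrite ffunE mxE.
by apply/rowP => j; rewrite mxE ffunE.
Qed.

Local Notation qd x y := (code_quotient_dist (code_coset x) (code_coset y)).

(** The term of the minimizing [z] is bounded by the sum over the whole dual code; for fixed [x] and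
    [z], summing over [y] gives the weight enumerator. *)
Lemma sum_exp_dist_le (t : R) : 0 <= t ->
  \sum_x \sum_y t ^+ qd x y <= (#|{: V}| * #|D|)%:R * (1 + t) ^+ d.
Proof.
move=> t0; rewrite natrM -mulrA -[X in X * _](mul1r) mulrC.
have -> : #|D|%:R * (1 + t) ^+ d * (1 * #|{: V}|%:R)
  = \sum_(x : V) \sum_(z in D) \sum_y t ^+ hweight (x + y + z).
  rewrite mul1r mulr_natr -sumr_const; apply: eq_bigr => x _.
  rewrite mulr_natl -sumr_const; apply: eq_bigr => z _.
  rewrite -sum_exp_hweight (reindex_onto (+%R (x + z)) (+%R (x + z)))/=.
    apply: eq_big => [y|y _]; first by rewrite rVF2_addK eqxx.
    by rewrite addrAC.
  by move=> y _; rewrite rVF2_addK.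
apply: ler_sum => x _; rewrite exchange_big; apply: ler_sum => y _ /=.
have [z zD ->] := code_quotient_dist_attained x y.
by rewrite (bigD1 z)//= lerDl sumr_ge0// => *; rewrite exprn_ge0.
Qed.

(** Averaging over representatives is averaging over cosets, as all cosets have the same size. *)
Lemma mean_dist_ge : C != 0%VS ->
  #|{: V}|%:R ^+ 2 * ((\dim C)%:R / (12 * (1 + ln (d%:R / (\dim C)%:R))))
  <= \sum_x \sum_y (qd x y)%:R :> R.
Proof.
move=> C0.
set N := #|{: V}|%:R; set M := \sum_x _.
have N0 : 0 < N by rewrite ltr0n; apply/card_gt0P; exists 0.
have k0 : (0 < \dim C)%N by rewrite lt0n dimv_eq0.
have kd : (\dim C <= d)%N by exact: dim_code_le.
set k := \dim C in k0 kd *.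
have d0 : (0 < d)%N by exact: leq_trans kd.
(* This choice makes [(1 + t) ^+ d] at most [exp (k / 4)], whereas [2 ^+ k] is at least
   [exp (k / 2)]; the surplus [k / 4] bounds [- ln t * m] from below. *)
pose t : R := k%:R / (4 * d%:R).
have t0 : 0 < t by rewrite divr_gt0 ?mulr_gt0 ?ltr0n.
pose m := M / N ^+ 2.
have m0 : 0 <= m.
  apply: divr_ge0; last exact/exprn_ge0/ltW.
  by apply: sumr_ge0 => x _; apply: sumr_ge0.
rewrite mulrC -ler_pdivlMr ?exprn_gt0// -/m.
apply: mean_le_of_ln => //; rewrite ?ltr0n ?ler_nat//.
rewrite -/t mulNr lerNr.
(* Jensen on pairs, with [t ^+ qd x y] written as the exponential of [ln t * qd x y]. *)
have J : N ^+ 2 * expR (ln t * m) <= N * #|D|%:R * (1 + t) ^+ d.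
  rewrite /N -natrM; apply: le_trans (sum_exp_dist_le (ltW t0)).
  rewrite -natrX -mulnn -card_prod pair_bigA/=.
  rewrite (eq_bigr (fun p : V * V => expR (ln t * (qd p.1 p.2)%:R))); last first.
    by move=> p _; rewrite mulrC expRM_natl lnK.
  apply: jensen_expR; rewrite -mulr_sumr /m /M pair_bigA/=.
  rewrite card_prod natrM -/N -expr2 mulrCA; congr (_ * _).
  by rewrite mulrC divfK// expf_neq0// gt_eqF.
have ND : N = 2 ^+ k * #|D|%:R.
  by rewrite /N -(card_code_dual R C) natrM card_vspace card_Fp// natrX.
have D0 : 0 < #|D|%:R :> R.
  by rewrite ltr0n; apply/card_gt0P; exists 0; exact: dual_code0.
have {}J : 2 ^+ k * expR (ln t * m) <= (1 + t) ^+ d.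
  rewrite -(ler_pM2l (mulr_gt0 N0 D0)); apply: le_trans J.
  rewrite (_ : N ^+ 2 * _ = N * N * expR (ln t * m)) ?expr2//.
  by rewrite [X in _ <= _ * X * _]ND -!mulrA (mulrCA #|D|%:R).
have td : (1 + t) ^+ d <= expR (k%:R / 4).
  have -> : k%:R / 4 = d%:R * t.
    by rewrite /t; field; rewrite pnatr_eq0 -lt0n.
  by rewrite expRM_natl lerXn2r ?nnegrE ?expR_ge0 ?expR_ge1Dx ?addr_ge0// ltW.
have k2 : expR (k%:R / 2) <= 2 ^+ k :> R.
  by rewrite expRM_natl lerXn2r ?nnegrE ?expR_ge0 ?expR_half_le2.
have : expR (k%:R / 2 + ln t * m) <= expR (k%:R / 4).
  rewrite expRD; apply: le_trans td; apply: le_trans J.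
  by rewrite ler_wpM2r ?expR_ge0.
by rewrite ler_expR; lra.
Qed.

End QuotientDistance.

(** * Lipschitz norms and the distortion bound *)

Lemma hweight_delta (d : nat) (j : 'I_d) :
  hweight (delta_mx 0 j : 'rV['F_2]_d) = 1%N.
Proof.
rewrite hweight_sum (bigD1 j)//= big1 => [|i ij].
  by rewrite mxE !eqxx.
by rewrite mxE (negPf ij) andbF eqxx.
Qed.

Lemma Lip_norm_ge (R : realType) (X Y : metricType R) (f : X -> Y) (p q : X) :
  p != q -> ((mdist (f p) (f q) / mdist p q)%:E <= Lip_norm f)%E.
Proof.
move=> pq; rewrite /Lip_norm le_max; apply/orP; right.
by apply: ereal_sup_ubound; exists (p, q).
Qed.

Lemma Lip_norm_range_inv_ge (R : realType) (X Y : metricType R) (f : X -> Y)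
    (p q : X) : injective f -> p != q ->
  ((mdist p q / mdist (f p) (f q))%:E <= Lip_norm (@range_inv X Y f))%E.
Proof.
move=> finj pq.
have fr x : f x \in range f by apply/mem_set; exists x.
have inv x : range_inv (SigSub (fr x)) = x.
  apply: finj; rewrite /range_inv; case: cid2 => x' _ /= ->.
  by [].
have fpq : SigSub (fr p) != SigSub (fr q) :> range f.
  by apply: contra_neq pq => /(congr1 val)/= /finj.
by have := @Lip_norm_ge R _ _ (@range_inv X Y f) _ _ fpq; rewrite !inv.
Qed.

(** Reduces to finite Lipschitz constants [A] and [B]. Two distinct points are required because a
    one-point space has distortion 0. *)
Lemma le_Ydistortion (R : realType) (X Y : metricType R) (r : R) :
  (exists p q : X, p != q) ->
  (forall (f : X -> Y) (A B : R), 0 <= A -> 0 <= B ->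
    (forall p q, mdist (f p) (f q) <= A * mdist p q) ->
    (forall p q, mdist p q <= B * mdist (f p) (f q)) -> r <= A * B) ->
  (r%:E <= Ydistortion Y X)%E.
Proof.
move=> [p [q pq]] H; apply: le_ereal_inf_tmp => _ [f _ <-].
rewrite /distortion; case: asboolP => [finj|_]; last by rewrite leey.
have fneq x y : x != y -> f x != f y by apply: contra_neq => /finj.
have := Lip_norm_ge f; have := fun x y => @Lip_norm_range_inv_ge _ _ _ _ x y finj.
case: (Lip_norm f) => [A||]; case: (Lip_norm _) => [B||] Binv Af;
  have := Af _ _ pq; have := Binv _ _ pq => //.
- rewrite !lee_fin => B0 A0; apply: (H f).
  + by apply: le_trans A0; rewrite divr_ge0 ?mdist_ge0.
  + by apply: le_trans B0; rewrite divr_ge0 ?mdist_ge0.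
  + move=> x y; have [->|xy] := eqVneq x y; first by rewrite !mdistxx mulr0.
    by have := Af _ _ xy; rewrite lee_fin ler_pdivrMr ?mdist_gt0.
  + move=> x y; have [->|xy] := eqVneq x y; first by rewrite !mdistxx mulr0.
    by have := Binv _ _ xy; rewrite lee_fin ler_pdivrMr ?mdist_gt0// fneq.
(* With one norm infinite the product is [+oo] only if the other is positive, since [0 * +oo = 0];
   the distinct points [p] and [q] ensure this. *)
- move=> _; rewrite lee_fin => A0; rewrite gt0_muley ?leey// lte_fin.
  by apply: lt_le_trans A0; rewrite divr_gt0 ?mdist_gt0// fneq.
- rewrite lee_fin => B0 _; rewrite gt0_mulye ?leey// lte_fin.
  by apply: lt_le_trans B0; rewrite divr_gt0 ?mdist_gt0// fneq.
- by move=> _ _; rewrite mulyy leey.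
Qed.

Theorem theorem3p4 (R : realType) :
  exists c : R, 0 < c /\
    forall (d : nat) (C : {vspace 'rV['F_2]_d}),
      (1 <= d)%N -> C != 0%VS ->
      ((c * (min_weight C)%:R *
         ((\dim C)%:R / (d%:R + d%:R * ln (d%:R / (\dim C)%:R))))%:E
       <= c1 (code_quotient R C))%E.
Proof.
(* The bound [2 * w * m / d] with [m = k / (12 * (1 + L))] gives the constant 2/12. *)
exists 6^-1; split=> [|d C d0 C0]; first by rewrite invr_gt0.
pose qd x y := code_quotient_dist (code_coset R C x) (code_coset R C y).
set k := \dim C; set L := ln _; set w := min_weight C.
set N : R := #|{: 'rV['F_2]_d}|%:R.
have mean : N ^+ 2 * (k%:R / (12 * (1 + L))) <= \sum_x \sum_y (qd x y)%:R.
  exact: mean_dist_ge.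
have k0 : (0 < k)%N by rewrite lt0n dimv_eq0.
have kd : (k <= d)%N by exact: dim_code_le.
have dR : 0 < d%:R :> R by rewrite ltr0n.
have L0 : 0 <= L by rewrite ln_ge0// ler_pdivlMr ?ltr0n// mul1r ler_nat.
have N0 : 0 < N by rewrite ltr0n; apply/card_gt0P; exists 0.
have onepL : 0 < 1 + L by rewrite ltr_pwDl.
set m := k%:R / _ in mean.
have m0 : 0 < m by rewrite divr_gt0 ?mulr_gt0 ?ltr0n.
apply: le_Ydistortion.
  (* If the quotient had a single point, all distances would vanish, against the positive mean. *)
  apply: contrapT => /forallNP allQ.
  have : 0 < \sum_x \sum_y (qd x y)%:R :> R.
    by apply: lt_le_trans mean; rewrite mulr_gt0 ?exprn_gt0.
  rewrite big1 ?ltxx// => x _; rewrite big1// => y _.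
  have [xy|xy] := eqVneq (code_coset R C x) (code_coset R C y).
    by rewrite -[LHS]/(mdist (code_coset R C x) _) xy mdistxx.
  by case: (allQ (code_coset R C x)); exists (code_coset R C y).
move=> f A B A0 B0 Af Bf.
pose g x := f (code_coset R C x).
have P : 2 * w%:R * \sum_x \sum_y mdist (g x) (g y)
   <= N * \sum_j \sum_x mdist (g (x + delta_mx 0 j)) (g x).
  by apply: poincare_L1 => x z zD; rewrite /g code_cosetK.
(* Adjacent vertices of the cube have cosets at distance at most 1, so each edge is stretched by at
   most [A]. *)
have up : \sum_j \sum_x mdist (g (x + delta_mx 0 j)) (g x) <= d%:R * (N * A).
  have -> : d%:R * (N * A) = \sum_(j < d) \sum_(x : 'rV['F_2]_d) A.
    by rewrite !sumr_const card_ord -[A *+ _]mulr_natl -[RHS]mulr_natl.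
  apply: ler_sum => j _; apply: ler_sum => x _; apply: le_trans (Af _ _) _.
  rewrite ler_piMr// lern1; apply: leq_trans (code_quotient_dist_le _ _ _ _) _.
  by rewrite addrAC rVF2_addxx add0r hweight_delta.
have lo : \sum_x \sum_y (qd x y)%:R <= B * \sum_x \sum_y mdist (g x) (g y).
  rewrite mulr_sumr; apply: ler_sum => x _.
  by rewrite mulr_sumr; apply: ler_sum => y _; exact: Bf.
have main : 2 * w%:R * (N ^+ 2 * m) <= N ^+ 2 * (d%:R * (A * B)).
  apply: (@le_trans _ _ (2 * w%:R * (B * \sum_x \sum_y mdist (g x) (g y)))).
    by rewrite ler_wpM2l ?mulr_ge0// (le_trans mean lo).
  rewrite mulrCA; apply: (@le_trans _ _ (B * (N * (d%:R * (N * A))))).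
    by rewrite ler_wpM2l// (le_trans P)// ler_wpM2l// ltW.
  by rewrite le_eqVlt; apply/orP; left; apply/eqP; ring.
move: main; rewrite mulrCA ler_pM2l ?exprn_gt0// -ler_pdivrMl//.
apply: le_trans; rewrite le_eqVlt; apply/orP; left; apply/eqP.
rewrite /m; field.
by rewrite -[X in X + _ * L]mulr1 -mulrDr mulf_neq0 !gt_eqF.
Qed.
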